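(* For every real Banach space $Y$, the pair $(\ell_\infty^4,Y)$ has the Bishop-Phelps-Bollobás property for operators (BPBp) if and only if $Y$ has the approximate hyperplane sum property for $\ell_\infty^4$ (AHSp-$\ell_\infty^4$). Moreover: (a) if $(\ell_\infty^4,Y)$ has the BPBp with the function $\eta$, then $Y$ has the AHSp-$\ell_\infty^4$ with the function $\gamma(\varepsilon)=\eta\bigl(\frac{\varepsilon}{48}\bigr)$; (b) if $Y$ has the AHSp-$\ell_\infty^4$ with the function $\gamma$, then the pair $(\ell_\infty^4,Y)$ has the BPBp with the function $\eta(\varepsilon)=\bigl(\gamma\bigl(\frac{\varepsilon}{3}\bigr)\bigr)^2$.
   Context: All spaces are real. $B_X$, $S_X$, $X^*$ denote the closed unit ball, unit sphere and topological dual of $X$; $L(X,Y)$ is the space of bounded linear operators with the operator norm; $\ell_\infty^4$ is $\mathbb{R}^4$ with the max norm. BPBp: Let $\eta:(0,1)\to\mathbb{R}$ satisfy $0<\eta(\varepsilon)<\varepsilon$ for all $\varepsilon$. The pair $(X,Y)$ of Banach spaces has the BPBp with the function $\eta$ if for every $0<\varepsilon<1$, every $T\in S_{L(X,Y)}$ and every $x_0\in S_X$ with $\|T(x_0)\|>1-\eta(\varepsilon)$, there exist $u_0\in S_X$ and $S\in S_{L(X,Y)}$ such that $\|S(u_0)\|=1$, $\|u_0-x_0\|<\varepsilon$ and $\|S-T\|<\varepsilon$. The pair has the BPBp if it has it with some such $\eta$. $M_Y^4=\{(y_i)_{i\le 4}\in (B_Y)^4: y_{i_1}-y_{i_2}+y_{i_3}\in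 B_Y \text{ for all } 1\le i_1<i_2<i_3\le 4\}$. AHSp-$\ell_\infty^4$: Let $\gamma:(0,1)\to\mathbb{R}$ satisfy $0<\gamma(\varepsilon)<\varepsilon$ for all $\varepsilon$. $Y$ has the AHSp-$\ell_\infty^4$ with the function $\gamma$ if for every $0<\varepsilon<1$ and every $(y_i)_{i\le 4}\in M_Y^4$ the following holds: if there exist a nonempty $A\subset\{1,2,3,4\}$ and $y^*\in S_{Y^*}$ such that $y^*(y_i)>1-\gamma(\varepsilon)$ for each $i\in A$, then there exists $(z_i)_{i\le 4}\in M_Y^4$ with $\|z_i-y_i\|<\varepsilon$ for every $i\le 4$ and $\|\sum_{i\in A}z_i\|=|A|$. $Y$ has the AHSp-$\ell_\infty^4$ if it has it with some such $\gamma$. *)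

(* Defs.v *)
From HB Require Import structures.
From mathcomp Require Import all_boot all_order all_algebra.
From mathcomp Require Import all_classical all_reals all_analysis.
Set Implicit Arguments.
Unset Strict Implicit.
Unset Printing Implicit Defensive.
Import Order.TTheory GRing.Theory Num.Theory.
Import numFieldNormedType.Exports.
Local Open Scope classical_set_scope.
Local Open Scope ring_scope.

(* The norm and the completeness of 'M[R]_(m, n) come from separate instances;
   this is their join.  The norm is [mx_norm], the maximum of the absolute
   values of the entries, so that 'rV[R]_4 is l_infty^4. *)
HB.instance Definition _ (R : realType) (m n : nat) :=
  Complete.on 'M[R]_(m, n).

Section Operators.
Variable R : realType.

Definition unit_ball (X : normedModType R) : set X := [set x | `|x| <= 1].

Definition unit_sphere (X : normedModType R) : set X := [set x | `|x| = 1].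

Definition bounded_op (X Y : normedModType R) (T : {linear X -> Y}) : Prop :=
  [bounded T x | x in @unit_ball X].

(* This [sup] is real-valued, hence meaningful only when [T] is bounded (it
   is 0 otherwise); every use below is for bounded operators. *)
Definition op_norm (X Y : normedModType R) (T : {linear X -> Y}) : R :=
  sup [set `|T x| | x in @unit_ball X].

(* S_{L(X,Y)} *)
Definition op_sphere (X Y : normedModType R) : set {linear X -> Y} :=
  [set T : {linear X -> Y} | bounded_op T /\ op_norm T = 1].

(* S_{Y^*}; R^o is R seen as a normed space over itself *)
Definition dual_sphere (Y : normedModType R) : set {linear Y -> R^o} :=
  [set f : {linear Y -> R^o} | continuous f /\ op_norm f = 1].

End Operators.

Arguments unit_ball {R} X.
Arguments unit_sphere {R} X.
Arguments op_sphere {R} X Y.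
Arguments dual_sphere {R} Y.

Section Properties.
Variable R : realType.

(* A function (0,1) -> R is encoded as a total function R -> R; all the
   properties below only depend on its values on (0,1). *)
Definition modulus (g : R -> R) : Prop :=
  forall e : R, 0 < e < 1 -> 0 < g e < e.

Definition BPBp_with (X Y : completeNormedModType R) (eta : R -> R) : Prop :=
  modulus eta /\
  forall e : R, 0 < e < 1 ->
  forall T : {linear X -> Y}, op_sphere X Y T ->
  forall x0 : X, unit_sphere X x0 -> `|T x0| > 1 - eta e ->
  exists (u0 : X) (S : {linear X -> Y}),
    [/\ unit_sphere X u0, op_sphere X Y S, `|S u0| = 1,
        `|u0 - x0| < e & op_norm (S \- T) < e].

Definition BPBp (X Y : completeNormedModType R) : Prop :=
  exists eta : R -> R, BPBp_with X Y eta.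

Definition M4 (Y : completeNormedModType R) : set ('I_4 -> Y) :=
  [set y | (forall i, unit_ball Y (y i)) /\
    forall i1 i2 i3 : 'I_4, (i1 < i2)%N -> (i2 < i3)%N ->
      unit_ball Y (y i1 - y i2 + y i3)].

Definition AHSp4_with (Y : completeNormedModType R) (gamma : R -> R) : Prop :=
  modulus gamma /\
  forall e : R, 0 < e < 1 ->
  forall y : 'I_4 -> Y, M4 y ->
  forall A : {set 'I_4}, A != finset.set0 ->
    (exists f : {linear Y -> R^o},
      dual_sphere Y f /\ forall i, i \in A -> f (y i) > 1 - gamma e) ->
    exists z : 'I_4 -> Y,
      [/\ M4 z, forall i, `|z i - y i| < e
        & `|\sum_(i in A) z i| = #|A|%:R].

Definition AHSp4 (Y : completeNormedModType R) : Prop :=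
  exists gamma : R -> R, AHSp4_with Y gamma.

End Properties.

(* Main.v *)
(* Let [v_i] be the vertex of the cube whose first [i] entries are [-1] and the
   others [1]. A vector with increasing entries, the last one being 1, is a
   convex combination of the [v_i], and up to sign the vertices of the cube are
   the [v_i] and the [v_i - v_j + v_k], [i < j < k]; so [T |-> (T v_i)] identifies
   the unit ball of L(l_infty^4, Y) with [M4 Y].

   From the BPBp to the AHSp, apply the BPBp to the normalised operator at the
   barycenter [b] of the [v_i], [i \in A]. Its entries are 1, -1 or at most 1/2
   in modulus, so [b] lies in every face of the ball containing a point near [b],
   and an operator attaining its norm near [b] attains it at [b].

   Conversely, a permutation and a change of sign bring [x0] to the form
   [\sum_i t_i v_i]. With [f] norming [T x0] (Hahn-Banach), take for [A] the [i]
   such that [f (T v_i) > 1 - gamma]: the total weight [t_i] outside [A] is less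
   than [gamma], so dropping these terms moves [x0] little. *)

Require Import Defs.
From HB Require Import structures.
From mathcomp Require Import all_boot all_order all_algebra.
From mathcomp Require Import all_classical all_reals all_analysis.
From mathcomp Require Import ring lra perm.
Import Order.TTheory GRing.Theory Num.Theory.
Import numFieldNormedType.Exports.
Local Open Scope classical_set_scope.
Local Open Scope ring_scope.

(** * Norming functionals *)

(** Homogeneity is asked only as an inequality, the form that passes to infima; using it for [t^-1]
    as well gives equality. *)
Definition sublinear {R : realType} {V : lmodType R} (p : V -> R) :=
  (forall x y, p (x + y) <= p x + p y) /\
  (forall t x, 0 < t -> p (t *: x) <= t * p x).

Lemma sublinearZ {R : realType} {V : lmodType R} {p : V -> R} :
  sublinear p -> forall t x, 0 < t -> p (t *: x) = t * p x.
Proof.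
move=> [_ hp] t x t0; apply/eqP; rewrite eq_le hp //=.
rewrite -ler_pdivlMl //.
by have := hp t^-1 (t *: x); rewrite scalerA mulVf ?gt_eqF// scale1r invr_gt0; exact.
Qed.

Lemma sublinear0 {R : realType} {V : lmodType R} {p : V -> R} :
  sublinear p -> p 0 = 0.
Proof.
move=> sp; have := sublinearZ sp 2 0; rewrite scaler0 => /(_ ltac:(lra)); lra.
Qed.

Lemma sublinear_geN {R : realType} {V : lmodType R} {p : V -> R} :
  sublinear p -> forall x, - p (- x) <= p x.
Proof.
move=> sp x; have := sp.1 x (- x); rewrite subrr sublinear0 //; lra.
Qed.

(** Subadditivity passes to the infimum because [p x + q y] is at least [r x + r y], where [r] is
    the smaller of the comparable [p] and [q]. *)
Lemma sublinear_chain_inf {R : realType} {V : lmodType R} (p0 : V -> R)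
    (A : set (V -> R)) :
  A !=set0 -> (forall p, A p -> sublinear p /\ forall x, p x <= p0 x) ->
  (forall p q, A p -> A q ->
    (forall x, p x <= q x) \/ (forall x, q x <= p x)) ->
  let m x := inf [set p x | p in A] in
  sublinear m /\ forall p, A p -> forall x, m x <= p x.
Proof.
move=> [a Aa] sA tA m.
have mle p : A p -> forall x, m x <= p x.
  move=> Ap x; apply: ge_inf; last by exists p.
  (* A lower bound at [x] common to the whole chain: [q x >= - q (- x) >= - p0 (- x)]. *)
  exists (- p0 (- x)) => _ [q /sA[sq qp0] <-].
  by apply: le_trans (sublinear_geN sq x); rewrite lerN2.
have lem c x : (forall p, A p -> c <= p x) -> c <= m x.
  move=> h; apply: lb_le_inf; first by exists (a x), a.
  by move=> _ [q Aq <-]; exact: h.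
split=> //; split=> [x y|t x t0].
- rewrite -lerBlDr; apply: (lem _ x) => p Ap; rewrite lerBlDr [p x + _]addrC -lerBlDr.
  apply: (lem _ y) => q Aq; rewrite lerBlDr.
  have [pq|qp] := tA _ _ Ap Aq.
  + apply: le_trans (mle _ Ap _) _; apply: le_trans ((sA _ Ap).1.1 x y) _.
    by rewrite addrC lerD2r.
  + apply: le_trans (mle _ Aq _) _; apply: le_trans ((sA _ Aq).1.1 x y) _.
    by rewrite addrC lerD2l.
- rewrite -ler_pdivrMl//; apply: (lem _ x) => p Ap; rewrite ler_pdivrMl//.
  exact: le_trans (mle _ Ap _) ((sA _ Ap).1.2 t x t0).
Qed.

Lemma minimal_sublinear {R : realType} {V : lmodType R} (p0 : V -> R) :
  sublinear p0 ->
  exists p : V -> R, [/\ sublinear p, forall x, p x <= p0 x &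
    forall q, sublinear q -> (forall x, q x <= p x) -> q = p].
Proof.
move=> sp0.
pose P (p : V -> R) := sublinear p /\ forall x, p x <= p0 x.
pose T := {p | P p}.
(* The order is reversed, so that a maximal element for Zorn is a minimal functional. *)
pose le (p q : T) := `[< forall x, sval q x <= sval p x >].
have [||||[p [sp pp0]] pmax] := @Zorn T le.
- by move=> p; apply/asboolP.
- move=> p q r /asboolP qp /asboolP rq; apply/asboolP => x.
  exact: le_trans (rq x) (qp x).
- move=> [p hp] [q hq] /asboolP qp /asboolP pq; apply: eq_exist => /=; apply/funext => x.
  by apply/le_anti; rewrite qp pq.
- move=> A tA; have [[a Aa]|A0] := pselect (A !=set0); last first.
    exists (exist P p0 (conj sp0 (fun=> lexx _))) => s As.
    by case: A0; exists s.
  have [|||sm mle] := sublinear_chain_inf p0 (sval @` A).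
  + by exists (sval a), a.
  + by move=> _ [[p hp] _ <-].
  + move=> _ _ [p Ap <-] [q Aq <-].
    by have [/asboolP|/asboolP] := tA _ _ Ap Aq; [right|left].
  + have mp0 x : inf [set p x | p in sval @` A] <= p0 x.
      by apply: le_trans (mle (sval a) _ x) ((svalP a).2 x); exists a.
    exists (exist P _ (conj sm mp0)) => s As; apply/asboolP => x /=.
    by apply: mle; exists s.
- exists p; split=> // q sq qp.
  have qp0 x : q x <= p0 x := le_trans (qp x) (pp0 x).
  by have /(congr1 sval) := pmax (exist P q (conj sq qp0)) (introT (asboolP _) qp).
Qed.

(* The sublinear functional obtained from [p] by making it as small as possible
   at [- y]; it lies below [p] and takes the value [- p y] there. *)
Definition sublinear_slope {R : realType} {V : lmodType R} (p : V -> R) (y x : V) :=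
  inf [set p (x + t *: y) - t * p y | t in [set t : R | 0 <= t]].

Section Slope.
Context {R : realType} {V : lmodType R} {p : V -> R} (sp : sublinear p) (y : V).

Lemma sublinear_slope_le t x :
  0 <= t -> sublinear_slope p y x <= p (x + t *: y) - t * p y.
Proof.
move=> t0; apply: ge_inf; last by exists t.
(* The infimum is over a set bounded below, since [s * p y = p (s *: y) <= p (- x) + p (x + s *:
   y)]. *)
exists (- p (- x)) => _ [s /= s0 <-].
have -> : s * p y = p (s *: y).
  move: s0; rewrite le_eqVlt => /predU1P[<-|s0].
    by rewrite scale0r mul0r sublinear0.
  by rewrite sublinearZ.
have := sp.1 (- x) (x + s *: y); rewrite addKr; lra.
Qed.

Lemma le_sublinear_slope c x :
  (forall t, 0 <= t -> c <= p (x + t *: y) - t * p y) -> c <= sublinear_slope p y x.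
Proof.
move=> h; apply: lb_le_inf => [|_ [t t0 <-]]; last exact: h.
by exists (p (x + 0 *: y) - 0 * p y), 0 => /=.
Qed.

Lemma sublinear_slope_le_id x : sublinear_slope p y x <= p x.
Proof. by have := sublinear_slope_le 0 x (lexx _); rewrite scale0r mul0r addr0 subr0. Qed.

Lemma sublinear_slope_sublinear : sublinear (sublinear_slope p y).
Proof.
split=> [x z|s x s0].
- rewrite -lerBlDr; apply: le_sublinear_slope => t t0; rewrite lerBlDr [_ - t * _ + _]addrC -lerBlDr.
  apply: le_sublinear_slope => u u0; rewrite lerBlDr.
  apply: le_trans (sublinear_slope_le (t + u) (x + z) (addr_ge0 t0 u0)) _.
  have := sp.1 (x + t *: y) (z + u *: y).
  rewrite addrACA -scalerDl; lra.
- rewrite -ler_pdivrMl//; apply: le_sublinear_slope => t t0; rewrite ler_pdivrMl//.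
  apply: le_trans (sublinear_slope_le (s * t) (s *: x) (mulr_ge0 (ltW s0) t0)) _.
  by rewrite mulrBr mulrA -scalerA -scalerDr lerD2r sp.2.
Qed.

End Slope.

(** By minimality [p] equals its slope along every [y]; the term [t = 1] of that infimum gives
    [p x <= p (x + y) - p y], the reverse of subadditivity. *)
Lemma minimal_sublinear_linear {R : realType} {V : lmodType R} (p : V -> R) :
  sublinear p -> (forall q, sublinear q -> (forall x, q x <= p x) -> q = p) ->
  linear (p : V -> R^o).
Proof.
move=> sp pmin.
have pD x y : p (x + y) = p x + p y.
  apply/le_anti; rewrite sp.1 /=.
  have {1}<- := pmin _ (sublinear_slope_sublinear sp y) (sublinear_slope_le_id sp y).
  rewrite -lerBrDr; have := sublinear_slope_le sp y 1 x ler01.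
  by rewrite scale1r mul1r.
have pN x : p (- x) = - p x.
  by apply/eqP; rewrite -addr_eq0 -pD addNr sublinear0.
move=> t x y; rewrite pD; congr (_ + _).
have [t0|t0|<-] := ltgtP 0 t.
- by rewrite sublinearZ.
- by rewrite -[t *: x]opprK -scaleNr pN sublinearZ ?oppr_gt0// mulNr opprK.
- by rewrite scale0r sublinear0// scale0r.
Qed.

(** Take a minimal functional below the slope of the norm along [w]: at [- w] that slope is at most
    minus the norm of [w], which forces equality at [w]. *)
Lemma hahn_banach_norming {R : realType} {Y : normedModType R} (w : Y) :
  exists f : {linear Y -> R^o}, (forall x, `|f x| <= `|x|) /\ f w = `|w|.
Proof.
have sN : sublinear (fun x : Y => `|x|).
  by split=> [|t x t0]; [exact: ler_normD|rewrite normrZ gtr0_norm].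
have [p [sp ple pmin]] := minimal_sublinear _ (sublinear_slope_sublinear sN w).
have pl := minimal_sublinear_linear _ sp pmin.
pose f : {linear Y -> R^o} := HB.pack (p : Y -> R^o) (GRing.isLinear.Build _ _ _ _ _ pl).
have fle x : f x <= `|x| := le_trans (ple x) (sublinear_slope_le_id sN w x).
have fNle x : - f x <= `|x| by rewrite -linearN -(normrN x) fle.
exists f; split=> [x|]; first by rewrite ler_norml lerNl fNle fle.
apply/le_anti; rewrite fle /=.
have := le_trans (ple (- w)) (sublinear_slope_le sN w 1 (- w) ler01).
by rewrite scale1r addNr normr0 mul1r sub0r -[p (- w)]/(f (- w)) linearN lerN2.
Qed.

(** * Operator norms and the max norm on row vectors *)

Section OperatorNorm.
Context {R : realType} {X Y : normedModType R}.
Implicit Types T : {linear X -> Y}.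

Let ball_nonempty T : [set `|T x| | x in unit_ball X] !=set0.
Proof. by exists `|T 0|, 0 => //; rewrite /unit_ball /= normr0. Qed.

Lemma op_norm_le T c : (forall x, `|x| <= 1 -> `|T x| <= c) -> op_norm T <= c.
Proof. by move=> h; apply: ge_sup => // _ [x x1 <-]; exact: h. Qed.

(** The constant [c] certifies that the set is bounded, so that [sup] is not its default value 0. *)
Lemma le_op_norm T c : (forall x, `|x| <= 1 -> `|T x| <= c) ->
  forall x, `|x| <= 1 -> `|T x| <= op_norm T.
Proof.
move=> h x x1; apply: ub_le_sup; last by exists x.
by exists c => _ [z z1 <-]; exact: h.
Qed.

(** As [sup] defaults to 0, the value 1 can only come from a genuine supremum. *)
Lemma op_norm1_contracting T : op_norm T = 1 -> forall x, `|x| <= 1 -> `|T x| <= 1.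
Proof.
move=> T1 x x1; have [[_ ub]|nsup] := pselect (has_sup [set `|T x| | x in unit_ball X]).
  by rewrite -T1; apply: ub_le_sup => //; exists x.
by move: T1; rewrite /op_norm sup_out// => /esym/eqP; rewrite oner_eq0.
Qed.

Lemma op_norm1_le T : op_norm T = 1 -> forall x, `|T x| <= `|x|.
Proof.
move=> T1 x; have [->|x0] := eqVneq x 0; first by rewrite linear0 !normr0.
have n0 : 0 < `|x| by rewrite normr_gt0.
have := op_norm1_contracting T T1 (`|x|^-1 *: x).
rewrite linearZ /= !normrZ normfV normr_id mulVf ?gt_eqF// => /(_ (lexx _)).
by rewrite ler_pdivrMl// mulr1.
Qed.

Lemma contracting_op_sphere T :
  (forall x, `|x| <= 1 -> `|T x| <= 1) -> 1 <= op_norm T -> op_sphere X Y T.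
Proof.
move=> T1 T2; split; last by apply/le_anti; rewrite T2 op_norm_le.
exists 1; split=> // M M1 x x1; exact: le_trans (T1 x x1) (ltW M1).
Qed.

End OperatorNorm.

Lemma norming_dual_sphere {R : realType} {Y : normedModType R} (w : Y) : w != 0 ->
  exists f : {linear Y -> R^o}, dual_sphere Y f /\ f w = `|w|.
Proof.
move=> w0; have [f [fle fw]] := hahn_banach_norming w.
exists f; split=> //; split.
- apply/linear_bounded_continuous/linear_boundedP; near=> M => x.
  apply: le_trans (fle x) _; rewrite ler_peMl//.
- apply/le_anti/andP; split.
    by apply: op_norm_le => x; apply: le_trans.
  have e : `| `|w|^-1 *: w| = 1 by rewrite normrZ normfV normr_id mulVf// normr_eq0.
  have fe : `|f (`|w|^-1 *: w)| = 1.
    by rewrite linearZ /= fw [_ *: _]mulVf ?normr1 // normr_eq0.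
  rewrite -fe; apply: (@le_op_norm _ _ _ f 1) => [x|]; last by rewrite e.
  exact: le_trans.
Unshelve. all: by end_near. Qed.

Section RowSpace.
Context {R : realType}.

Lemma rV_norm_leP {n} (x : 'rV[R]_n) c : 0 <= c ->
  `|x| <= c <-> forall i, `|x 0 i| <= c.
Proof.
move=> c0; rewrite [`|x|]mx_normrE; split.
- move=> /bigmax_leP[_ h] i; exact: (h (0, i)).
- move=> h; apply/bigmax_leP; split=> // -[i j] _ /=; by rewrite ord1.
Qed.

Lemma rV_coord_le {n} (x : 'rV[R]_n) i : `|x 0 i| <= `|x|.
Proof. by move: i; apply/rV_norm_leP. Qed.

(* Induction on the number of coordinates of modulus [< 1], each of which is
   moved to [1] and to [-1] by convexity. *)
Lemma sign_vector_bound {n} {Y : normedModType R} (T : {linear 'rV[R]_n -> Y}) c :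
  (forall x : 'rV[R]_n, (forall k, x 0 k = 1 \/ x 0 k = -1) -> `|T x| <= c) ->
  forall x, `|x| <= 1 -> `|T x| <= c.
Proof.
move=> h; suff H m : forall x : 'rV[R]_n, (forall i : 'I_n, (i < m)%N -> `|x 0 i| <= 1) ->
    (forall i : 'I_n, (m <= i)%N -> x 0 i = 1 \/ x 0 i = -1) -> `|T x| <= c.
  move=> x /(rV_norm_leP _ _ ler01) x1; apply: (H n) => // i.
  by rewrite leqNgt ltn_ord.
elim: m => [|m IH] x xm xs; first by apply: h => k; exact: xs.
have [mn|nm] := ltnP m n; last first.
  apply: IH => i im; first by apply: xm; exact: ltnW.
  by have := leq_trans (ltn_ord i) (leq_trans nm im); rewrite ltnn.
pose k := Ordinal mn.
pose u e : 'rV[R]_n := \row_i (if i == k then e else x 0 i).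
have Tu e : e = 1 \/ e = -1 -> `|T (u e)| <= c.
  move=> he; apply: IH => i im; rewrite mxE; case: eqP => [_|ik].
  - by case: he => ->; rewrite ?normrN normr1.
  - by apply: xm; exact: ltnW.
  - exact: he.
  - apply: xs; rewrite ltn_neqAle im andbT; apply/eqP => mi.
    by apply: ik; apply/val_inj.
have -> : x = ((1 + x 0 k) / 2) *: u 1 + ((1 - x 0 k) / 2) *: u (-1).
  apply/rowP => i; rewrite !mxE; case: eqP => [->|_]; lra.
have /ler_normlP[xk1 xk2] := xm k (ltnSn m).
rewrite linearD !linearZ /=; apply: le_trans (ler_normD _ _) _.
rewrite [`|_ *: T (u 1)|]normrZ [`|_ *: T (u (-1))|]normrZ.
have /= T1 := Tu 1 (or_introl erefl); have /= T2 := Tu (-1) (or_intror erefl).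
have p1 : 0 <= (1 + x 0 k) / 2 by lra.
have p2 : 0 <= (1 - x 0 k) / 2 by lra.
rewrite (ger0_norm p1) (ger0_norm p2).
apply: le_trans (lerD (ler_wpM2l p1 T1) (ler_wpM2l p2 T2)) _; lra.
Qed.

End RowSpace.

(** * The vertices of the cube *)

Lemma sum_ord4 {V : nmodType} (F : 'I_4 -> V) :
  \sum_i F i = F (inord 0) + F (inord 1) + F (inord 2) + F (inord 3).
Proof.
rewrite !big_ord_recr /= big_ord0 add0r.
by congr (F _ + F _ + F _ + F _); apply/val_inj; rewrite /= inordK.
Qed.

Lemma ord4_ind (P : 'I_4 -> Prop) :
  P (inord 0) -> P (inord 1) -> P (inord 2) -> P (inord 3) -> forall i, P i.
Proof. by move=> P0 P1 P2 P3 i; rewrite -(inord_val i); case: i => [[|[|[|[|?]]]] ?]. Qed.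

Section Vertices.
Context {R : realType}.
Implicit Types (x : 'rV[R]_4) (i j k : 'I_4).

Definition vertex i : 'rV[R]_4 := \row_k (if (k < i)%N then -1 else 1).

(* Barycentric coordinates with respect to the [vertex i]; they sum to the last
   entry of [x]. *)
Definition weight x i : R :=
  (x 0 i - (if i == 0%N :> nat then - x 0 (inord 3) else x 0 (inord i.-1))) / 2.

Lemma weight_is_linear i : linear (weight ^~ i : 'rV[R]_4 -> R^o).
Proof.
move=> a x z; rewrite -[RHS]/(a * weight x i + weight z i) /weight !mxE.
by case: ifP => _; ring.
Qed.

Lemma weight_vertex j i : weight (vertex j) i = (i == j)%:R.
Proof.
rewrite -[i == j]/(i == j :> nat); move: i j; apply: ord4_ind; apply: ord4_ind.
all: rewrite /weight /vertex !mxE !inordK //=; lra.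
Qed.

Lemma vertex_decomp x : x = \sum_i weight x i *: vertex i.
Proof.
apply/rowP; apply: ord4_ind; rewrite sum_ord4 !mxE /weight !inordK //=; lra.
Qed.

Lemma sum_weight x : \sum_i weight x i = x 0 (inord 3).
Proof. rewrite sum_ord4 /weight !inordK //=; lra. Qed.

Lemma norm_vertex_le i : `|vertex i| <= 1.
Proof.
apply/rV_norm_leP => // k; rewrite mxE.
by case: ifP; rewrite ?normrN normr1.
Qed.

(** At each coordinate the signs of the three vertices, in order, are some 1s followed by some -1s,
    so their alternating sum is 1 or -1. *)
Lemma norm_vertex3_le i j k : (i < j)%N -> (j < k)%N ->
  `|vertex i - vertex j + vertex k| <= 1.
Proof.
move=> ij jk; apply/rV_norm_leP => // l; rewrite !mxE ler_norml.
case: ifP => li; case: ifP => lj; case: ifP => lk; try lra.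
- by rewrite (ltn_trans li ij) in lj.
- by rewrite (ltn_trans lj jk) in lk.
Qed.

Context {Y : normedModType R}.

Lemma linear_vertexE (T : {linear 'rV[R]_4 -> Y}) x :
  T x = \sum_i weight x i *: T (vertex i).
Proof.
by rewrite {1}[x]vertex_decomp linear_sum; apply: eq_bigr => i _; rewrite linearZ.
Qed.

Definition of_vertices (y : 'I_4 -> Y) x : Y := \sum_i weight x i *: y i.

Fact of_vertices_is_linear y : linear (of_vertices y).
Proof.
move=> a x z; rewrite /of_vertices scaler_sumr -big_split /=.
apply: eq_bigr => i _; rewrite scalerA -scalerDl; congr (_ *: _).
exact: weight_is_linear.
Qed.

HB.instance Definition _ y := GRing.isLinear.Build R 'rV[R]_4 Y _ _
  (of_vertices_is_linear y).

Lemma of_verticesE y i : of_vertices y (vertex i) = y i.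
Proof.
rewrite /of_vertices (bigD1 i)//= weight_vertex eqxx scale1r big1 ?addr0// => j ji.
by rewrite weight_vertex (negbTE ji) scale0r.
Qed.

(** It suffices to treat sign vectors with last entry 1. Their nonzero weights alternate, starting
    and ending with 1, which leaves four vertices and four alternating triples. The bound [c] is
    arbitrary so as to cover differences of operators. *)
Lemma vertex_bound (T : {linear 'rV[R]_4 -> Y}) c :
  (forall i, `|T (vertex i)| <= c) ->
  (forall i j k, (i < j)%N -> (j < k)%N ->
    `|T (vertex i) - T (vertex j) + T (vertex k)| <= c) ->
  forall x, `|x| <= 1 -> `|T x| <= c.
Proof.
move=> T1 T3; apply: sign_vector_bound.
suff H x : x 0 (inord 3) = 1 -> (forall k, x 0 k = 1 \/ x 0 k = -1) -> `|T x| <= c.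
  move=> x xs; case: (xs (inord 3)) => x3; first exact: H.
  rewrite -normrN -linearN; apply: H => [|k]; rewrite mxE; first by rewrite x3 opprK.
  by case: (xs k) => ->; [right|left; rewrite opprK].
move=> x3 xs; rewrite linear_vertexE sum_ord4 /weight !inordK //= x3.
have e1 : (1 - 1) / 2 = 0 :> R by lra.
have e2 : (1 - - 1) / 2 = 1 :> R by lra.
have e3 : (- 1 - 1) / 2 = -1 :> R by lra.
have e4 : (- 1 - - 1) / 2 = 0 :> R by lra.
have e := (e1, e2, e3, e4, scale0r, scale1r, scaleN1r, addr0, add0r).
case: (xs (inord 0)) => ->; case: (xs (inord 1)) => ->; case: (xs (inord 2)) => ->;
  rewrite !e; first [exact: T1 | by apply: T3; rewrite !inordK].
Qed.

End Vertices.

(** * From the BPBp to the AHSp *)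

Section M4Operators.
Context {R : realType} {Y : completeNormedModType R}.

Lemma M4_contracting (T : {linear 'rV[R]_4 -> Y}) :
  M4 (fun i => T (vertex i)) <-> forall x, `|x| <= 1 -> `|T x| <= 1.
Proof.
split=> [[T1 T3]|T1]; first exact: vertex_bound.
split=> [i|i j k ij jk]; rewrite /unit_ball /=.
- by apply: T1; exact: norm_vertex_le.
- by rewrite -linearB -linearD; apply: T1; exact: norm_vertex3_le.
Qed.

Lemma of_vertices_contracting (y : 'I_4 -> Y) :
  M4 y -> forall x, `|x| <= 1 -> `|of_vertices y x| <= 1.
Proof.
move=> My; apply/M4_contracting; move: My; congr M4.
by apply/funext => i; rewrite /= of_verticesE.
Qed.

End M4Operators.

Lemma modulus_comp_div {R : realType} (g : R -> R) c :
  1 <= c -> modulus g -> modulus (fun e => g (e / c)).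
Proof.
move=> c1 mg e /andP[e0 e1].
have c0 : 0 < c by lra.
have ec : e / c <= e by rewrite ler_pdivrMr// ler_peMr// ltW.
have /mg /andP[-> ge] : 0 < e / c < 1 by rewrite divr_gt0//=; lra.
exact: lt_le_trans ge ec.
Qed.

Lemma modulus_sqr {R : realType} (g : R -> R) :
  modulus g -> modulus (fun e => g e ^+ 2).
Proof. by move=> mg e e01; have /andP[g0 ge] := mg e e01; nra. Qed.

Section BPBpAHSp.
Context {R : realType} {Y : completeNormedModType R}.
Implicit Types (A : {set 'I_4}).

Definition barycenter A : 'rV[R]_4 := #|A|%:R^-1 *: \sum_(i in A) vertex i.

Lemma linear_barycenter (T : {linear 'rV[R]_4 -> Y}) A :
  T (barycenter A) = #|A|%:R^-1 *: \sum_(i in A) T (vertex i).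
Proof. by rewrite linearZ linear_sum. Qed.

Lemma barycenterE A k : A != finset.set0 ->
  barycenter A 0 k = 1 - 2 * #|[set i in A | (k < i)%N]%SET|%:R / #|A|%:R.
Proof.
move=> A0; have a0 : #|A|%:R != 0 :> R by rewrite pnatr_eq0 cards_eq0.
rewrite /barycenter; have -> : \sum_(i in A) vertex i =
   \row_k (#|A|%:R - 2 * #|[set i in A | (k < i)%N]%SET|%:R) :> 'rV[R]_4.
  apply/rowP => l; rewrite summxE mxE -!sum1_card !natr_sum.
  rewrite big_mkcond [X in _ = X - _]big_mkcond [X in _ = _ - 2 * X]big_mkcond /=.
  rewrite mulr_sumr -sumrB; apply: eq_bigr => i _; rewrite !inE mxE.
  by case: (i \in A) => /=; last lra; case: ifP => _; lra.
by rewrite !mxE; field.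
Qed.

(** The entry is [1 - 2 n / a] with [n <= a <= 4]; if [0 < n < a], then [n / a] lies between 1/4 and
    3/4. *)
Lemma barycenter_coord A k : A != finset.set0 ->
  [\/ barycenter A 0 k = 1, barycenter A 0 k = -1 | `|barycenter A 0 k| <= 2^-1].
Proof.
move=> A0; rewrite barycenterE//.
have a0 : (0 < #|A|)%N by rewrite card_gt0.
have a4 : (#|A| <= 4)%N by rewrite -[X in (_ <= X)%N](card_ord 4) max_card.
have n_a : (#|[set i in A | (k < i)%N]%SET| <= #|A|)%N.
  by apply: subset_leq_card; apply/fintype.subsetP => i; rewrite inE => /andP[].
move: (#|_|) (#|A|) n_a a0 a4 => n a n_a a0 a4.
have [->|n0] := posnP n; first by constructor 1; lra.
have [na|na] := ltnP n a; last first.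
  have -> : n = a by apply/eqP; rewrite eqn_leq n_a.
  by constructor 2; rewrite mulfK ?pnatr_eq0 -?lt0n//; lra.
constructor 3; have {a0} a0 : 0 < a%:R :> R by rewrite ltr0n.
rewrite (_ : 1 - _ = (a%:R - 2 * n%:R) / a%:R); last by field; rewrite gt_eqF.
rewrite normrM normfV (gtr0_norm a0) ler_pdivrMr// ler_norml.
move: n0 na a4; rewrite -!(ler_nat R) -natr1; lra.
Qed.

Lemma norm_barycenter A : A != finset.set0 -> `|barycenter A| = 1.
Proof.
move=> A0; apply/le_anti/andP; split.
  apply/rV_norm_leP => // k.
  by case: (barycenter_coord _ k A0) => [->|->|]; rewrite ?normrN ?normr1//; lra.
(* The last entry is 1, because no index exceeds 3. *)
have := rV_coord_le (barycenter A) (inord 3); rewrite barycenterE//.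
rewrite (_ : [set _ in _ | _]%SET = finset.set0) ?cards0 ?mulr0 ?mul0r ?subr0 ?normr1//.
by apply/setP => i; rewrite !inE inordK// ltnNge -ltnS ltn_ord andbF.
Qed.

(* [u] close to [barycenter A] is of the form [b / 4 + 3 w / 4] with [b] the
   barycenter and [w] in the ball, because the entries of [b] other than [1] and
   [-1] stay away from both. *)
Lemma norm_attained_at_barycenter A (T : {linear 'rV[R]_4 -> Y}) u :
  A != finset.set0 -> (forall x, `|x| <= 1 -> `|T x| <= 1) ->
  `|u| <= 1 -> `|u - barycenter A| < 1 / 48 -> `|T u| = 1 ->
  `|T (barycenter A)| = 1.
Proof.
move=> A0 T1 u1 + Tu; have b1 : `|barycenter A| <= 1 by rewrite norm_barycenter.
have := barycenter_coord A ^~ A0; move: (barycenter A) b1 => b b1 bk ub.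
apply/le_anti; rewrite T1//=.
pose w := (4 / 3) *: (u - 4^-1 *: b).
have w1 : `|w| <= 1.
  apply/rV_norm_leP => // k.
  have := le_lt_trans (rV_coord_le (u - b) k) ub.
  have := le_trans (rV_coord_le u k) u1.
  have := bk k; rewrite !mxE ltr_norml !ler_norml.
  (* Where [b] is 1 or -1, the entry of [u] is near it and at most 1 in modulus; elsewhere
     [u - b / 4] is at most 1/48 + 3/8 < 3/4 in modulus. *)
  by move=> + /andP[u1k u2k] /andP[d1 d2]; case=> [e|e|/andP[b1k b2k]]; lra.
have uE : u = 4^-1 *: b + (3 / 4) *: w.
  by apply/rowP => k; rewrite !mxE; lra.
clearbody w; have := ler_normD (4^-1 *: T b) ((3 / 4) *: T w).
rewrite (_ : 4^-1 *: T b + (3 / 4) *: T w = T u) ?Tu; last first.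
  by rewrite [in RHS]uE linearD !linearZ.
rewrite [`|4^-1 *: _|]normrZ [`|(3 / 4) *: _|]normrZ !ger0_norm; [|lra..].
have := T1 w w1; lra.
Qed.

Lemma BPBp_with_AHSp4 eta : BPBp_with 'rV[R]_4 Y eta ->
  AHSp4_with Y (fun e => eta (e / 48%:R)).
Proof.
move=> [meta H]; split; first by apply: modulus_comp_div => //; lra.
move=> e /andP[e0 e1] y My A A0 [f [[_ f1] fy]].
have d01 : 0 < e / 48 < 1 by lra.
have /andP[eta0 etae] := meta _ d01.
set b := barycenter A; have b1 : `|b| = 1 := norm_barycenter _ A0.
have [T [T1 Ty]] : exists T : {linear 'rV[R]_4 -> Y},
    (forall x, `|x| <= 1 -> `|T x| <= 1) /\ forall i, T (vertex i) = y i.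
  exists (of_vertices y); split; [exact: of_vertices_contracting|exact: of_verticesE].
have a0 : 0 < #|A|%:R :> R by rewrite ltr0n card_gt0.
(* [f] exceeds [1 - eta (e / 48)] at each [y i] with [i] in [A], hence at their average [T b]. *)
have Tb : 1 - eta (e / 48) < `|T b|.
  apply: lt_le_trans (op_norm1_le f f1 _).
  apply: lt_le_trans (ler_norm _).
  have -> : f (T b) = #|A|%:R^-1 * \sum_(i in A) f (y i).
    rewrite linear_barycenter linearZ linear_sum; congr (_ * _).
    by apply: eq_bigr => i _; rewrite Ty.
  rewrite ltr_pdivlMl// mulr_natl -sumr_const.
  have [i iA] := set0Pn _ A0.
  apply: ltr_sum => [|j jA]; [by apply/hasP; exists i; rewrite ?mem_index_enum|exact: fy].
(* Membership in [M4] only gives [N <= 1], while the BPBp needs norm 1. Since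
   [1 - N < eta (e / 48) < e / 48], normalising moves each [y i] by less than [e / 48]. *)
set N := op_norm T.
have TN x : `|x| <= 1 -> `|T x| <= N := le_op_norm _ 1 T1 x.
have N1 : N <= 1 := op_norm_le _ _ T1.
have TbN : `|T b| <= N by apply: TN; rewrite b1.
have N0 : 0 < N by lra.
have NV1 : 1 <= N^-1 by rewrite invf_ge1.
pose T' : {linear 'rV[R]_4 -> Y} := N^-1 \*: T.
have T'E x : `|T' x| = N^-1 * `|T x| by rewrite normrZ ger0_norm// invr_ge0 ltW.
have T'1 x : `|x| <= 1 -> `|T' x| <= 1.
  by move=> x1; rewrite T'E ler_pdivrMl// mulr1 TN.
have sT' : op_sphere _ _ T'.
  apply: contracting_op_sphere => //; rewrite -(ler_pM2l N0) mulr1.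
  apply: op_norm_le => x x1; rewrite -ler_pdivrMl// -T'E.
  exact: le_op_norm T'1 _ x1.
have T'b : 1 - eta (e / 48) < `|T' b|.
  by rewrite T'E; apply: lt_le_trans Tb _; rewrite ler_peMl.
have [u [S [u1 [Sbd S1] Su ub ST]]] := H _ d01 T' sT' b b1 T'b.
have SC := op_norm1_contracting S S1.
(* [u] is within [e / 48 < 1 / 48] of [b], so the norm is attained at the barycenter itself. *)
have Sb : `|S b| = 1.
  by apply: norm_attained_at_barycenter Su => //; [rewrite u1|rewrite -/b; lra].
exists (fun i => S (vertex i)); split.
- exact/M4_contracting.
- move=> i; have v1 := @norm_vertex_le R i.
  (* The crude bound 2 on [S \- T'] only ensures that its [op_norm] is a genuine supremum. *)
  have SiT : `|(S \- T') (vertex i)| < e / 48.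
    apply: le_lt_trans ST; apply: (le_op_norm _ 2) v1 => x x1 /=.
    have := ler_normB (S x) (T' x); have := SC x x1; have := T'1 x x1; lra.
  have TiT : `|T' (vertex i) - T (vertex i)| <= 1 - N.
    rewrite -[X in _ - X]scale1r -scalerBl normrZ ger0_norm ?subr_ge0//.
    apply: le_trans (ler_wpM2l _ (TN _ v1)) _; first by rewrite subr_ge0.
    by rewrite mulrBl mulVf ?gt_eqF// mul1r.
  rewrite -Ty -(subrKA (T' (vertex i))).
  apply: le_lt_trans (ler_normD _ _) _.
  move: SiT TiT => /=; lra.
- have -> : \sum_(i in A) S (vertex i) = #|A|%:R *: S b.
    by rewrite linear_barycenter scalerA mulfV ?gt_eqF// scale1r.
  by rewrite normrZ Sb mulr1 ger0_norm// ltW.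
Qed.

End BPBpAHSp.
(** * From the AHSp to the BPBp *)

(** Split the sum of the [z i], of norm [#|A|], as the combination with coefficients [a i] plus the
    one with [1 - a i]. The latter has norm at most [#|A| - 1], so the former has norm at least
    1. *)
Lemma norm_convex_combination {R : realType} {Y : normedModType R} {I : finType}
    (A : {set I}) (z : I -> Y) (a : I -> R) :
  (forall i, `|z i| <= 1) -> `|\sum_(i in A) z i| = #|A|%:R ->
  (forall i, i \in A -> 0 <= a i) -> \sum_(i in A) a i = 1 ->
  `|\sum_(i in A) a i *: z i| = 1.
Proof.
move=> z1 zA a0 a1.
have bound (c : I -> R) : (forall i, i \in A -> 0 <= c i) ->
    `|\sum_(i in A) c i *: z i| <= \sum_(i in A) c i.
  move=> c0; apply: le_trans (ler_norm_sum _ _ _) _; apply: ler_sum => i iA.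
  by rewrite normrZ ger0_norm ?c0// ler_piMr ?c0.
apply/le_anti; rewrite -{1}a1 bound//=.
have ale i : i \in A -> a i <= 1.
  move=> iA; rewrite -a1 (bigD1 i)//= lerDl; apply: sumr_ge0 => j /andP[jA _]; exact: a0.
have /bound /= : forall i, i \in A -> 0 <= (fun i => 1 - a i) i.
  by move=> i iA; rewrite subr_ge0 ale.
rewrite sumrB a1 sumr_const => h.
have := ler_normD (\sum_(i in A) a i *: z i) (\sum_(i in A) (1 - a i) *: z i).
rewrite -big_split /= (eq_bigr z) ?zA; last first.
  by move=> i _; rewrite -scalerDl addrC subrK scale1r.
lra.
Qed.

Section AHSpBPBp.
Context {R : realType} {Y : completeNormedModType R}.
Implicit Types (x : 'rV[R]_4).

(** The convex hull of the four vertices. *)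
Let simplex x := (forall i, 0 <= weight x i) /\ \sum_i weight x i = 1.

(** The closeness of [S] to [T] is stated pointwise with a constant [c < e]: this is easily
    transported along an isometry and still yields a strict bound on the supremum. *)
Lemma AHSp4_approx_simplex gamma (e : R) (T : {linear 'rV[R]_4 -> Y}) x0 :
  AHSp4_with Y gamma -> 0 < e < 1 -> op_sphere _ _ T -> simplex x0 ->
  `|T x0| > 1 - gamma (e / 3) ^+ 2 ->
  exists (u : 'rV[R]_4) (S : {linear 'rV[R]_4 -> Y}),
    [/\ `|u| = 1, forall x, `|x| <= 1 -> `|S x| <= 1, `|S u| = 1, `|u - x0| < e &
      exists2 c, c < e & forall x, `|x| <= 1 -> `|S x - T x| <= c].
Proof.
move=> [mg H] /andP[e0 e1] [_ Tn] [t0 t1] Tx0.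
have e3 : 0 < e / 3 < 1 by lra.
have /andP[] := mg _ e3; set g := gamma _ in Tx0 * => g0 ge.
have T1 := op_norm1_contracting T Tn.
have gg : g ^+ 2 < 1 by rewrite expr_lt1 ?ltW//; lra.
have w0 : T x0 != 0 by rewrite -normr_gt0; apply: lt_trans Tx0; rewrite subr_gt0.
have [f [fS fw]] := norming_dual_sphere _ w0.
have f1 := op_norm1_le f fS.2.
pose t := weight x0.
pose A := [set i | 1 - g < f (T (vertex i))]%SET.
pose r := \sum_(i in ~: A) t i.
have tA : \sum_(i in A) t i = 1 - r.
  rewrite -t1 [X in _ = X - _](bigID (mem A)) /= [X in _ = _ + X - _](eq_bigl (mem (~: A))).
    by rewrite addrK.
  by move=> i; rewrite !inE.
have r0 : 0 <= r by apply: sumr_ge0.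
(* Markov's inequality, whence the square of [gamma]: the average of [1 - f (T (vertex i))] with
   weights [t i] is less than [g ^+ 2], and the values outside [A] are at least [g]. *)
have rg : r < g.
  rewrite -(ltr_pM2l g0) -expr2 /r mulr_sumr.
  apply: (@le_lt_trans _ _ (\sum_i t i * (1 - f (T (vertex i))))).
    rewrite [leRHS](bigID (mem (~: A))) /= -[leLHS]addr0; apply: lerD.
      apply: ler_sum => i; rewrite !inE -leNgt => fi.
      by rewrite mulrC ler_wpM2l// lerBrDl -lerBrDr.
    apply: sumr_ge0 => i _; rewrite mulr_ge0// subr_ge0.
    apply: le_trans (ler_norm _) _; apply: le_trans (f1 _) _; apply: T1; exact: norm_vertex_le.
  have -> : \sum_i t i * (1 - f (T (vertex i))) = 1 - `|T x0|.
    rewrite -fw linear_vertexE linear_sum -[in RHS]t1 -sumrB; apply: eq_bigr => i _.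
    by rewrite linearZ /= mulrBr mulr1.
  lra.
have q0 : 0 < 1 - r by lra.
have A0 : A != finset.set0.
  by apply: contraTneq q0 => A0; rewrite -tA A0 big_set0 ltxx.
have My : M4 (fun i => T (vertex i)) by exact/M4_contracting.
have [|z [Mz zy zA]] := H _ e3 _ My A A0.
  by exists f; split=> // i; rewrite inE.
(* The terms outside [A] are dropped and the remaining weights rescaled to sum to 1. *)
pose u := \sum_(i in A) (t i / (1 - r)) *: vertex i.
have tr0 i : i \in A -> 0 <= t i / (1 - r) by move=> _; rewrite divr_ge0// ltW.
have tr1 : \sum_(i in A) t i / (1 - r) = 1 by rewrite -mulr_suml tA mulfV// gt_eqF.
exists u, (of_vertices z); split.
- apply/le_anti/andP; split.
    apply: le_trans (ler_norm_sum _ _ _) _; rewrite -[leRHS]tr1; apply: ler_sum => i iA.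
    by rewrite normrZ ger0_norm ?tr0// ler_piMr ?tr0// norm_vertex_le.
  apply: le_trans (rV_coord_le u (inord 3)); rewrite summxE -[leLHS]tr1.
  apply: le_trans (ler_norm _); apply: ler_sum => i _.
  by rewrite !mxE inordK// ltnNge -ltnS ltn_ord mulr1.
- exact: of_vertices_contracting.
- rewrite linear_sum (eq_bigr (fun i => (t i / (1 - r)) *: z i)) => [|i _]; last first.
    by rewrite linearZ /= of_verticesE.
  by apply: norm_convex_combination => //; exact: Mz.1.
(* One [r] is the weight dropped outside [A], the other the weight added inside [A] by rescaling;
   [r < g < e / 3]. *)
- apply: (@le_lt_trans _ _ (r + r)); last by lra.
  have -> : u - x0 = \sum_(i in A) (t i / (1 - r) - t i) *: vertex i
                     - \sum_(i in ~: A) t i *: vertex i.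
    rewrite {1}[x0]vertex_decomp [X in _ - X](bigID (mem A)) /= opprD addrA -sumrB.
    congr (_ - _); last by apply: eq_bigl => i; rewrite !inE.
    by apply: eq_bigr => i _; rewrite scalerBl.
  apply: le_trans (ler_normB _ _) _; apply: lerD.
    have rE : \sum_(i in A) (t i / (1 - r) - t i) = r by rewrite sumrB tr1 tA; ring.
    rewrite -[leRHS]rE; apply: le_trans (ler_norm_sum _ _ _) _; apply: ler_sum => i iA.
    have p0 : 0 <= t i / (1 - r) - t i.
      by rewrite subr_ge0 ler_pdivlMr// ler_piMr//; lra.
    by rewrite normrZ (ger0_norm p0) ler_piMr// norm_vertex_le.
  apply: le_trans (ler_norm_sum _ _ _) _; apply: ler_sum => i iA.
  by rewrite normrZ ger0_norm// ler_piMr// norm_vertex_le.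
- pose d := \big[Order.max/0]_i `|z i - T (vertex i)|.
  have dle i : `|z i - T (vertex i)| <= d by exact: le_bigmax.
  have d0 : 0 <= d by apply: le_trans (dle 0).
  (* An alternating triple involves three differences [z i - T (vertex i)], each of norm at most
     [d < e / 3]; hence the division of [e] by 3. *)
  exists (3 * d).
    have : d < e / 3 by apply: bigmax_lt => //; lra.
    lra.
  move=> x x1; pose D : {linear 'rV[R]_4 -> Y} := of_vertices z \- T.
  have DE i : D (vertex i) = z i - T (vertex i) by rewrite /D /= of_verticesE.
  apply: (@vertex_bound _ _ D) x1 => [i|i j k _ _]; rewrite !DE.
    by have := dle i; lra.
  have := ler_normB (z i - T (vertex i)) (z j - T (vertex j)).
  have := ler_normD (z i - T (vertex i) - (z j - T (vertex j))) (z k - T (vertex k)).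
  have := dle i; have := dle j; have := dle k; lra.
Qed.

(** Choose the sign [s] that makes an entry of modulus 1 equal to 1, then sort increasingly: the
    last entry is 1, and the weights are half the successive increments, starting from -1. *)
Lemma sort_onto_simplex x0 : `|x0| = 1 ->
  exists (s : R) (p : 'S_4), [/\ s = 1 \/ s = -1 & simplex (s *: col_perm p x0)].
Proof.
move=> x01.
have [k xk] : exists k, `|x0 0 k| = 1.
  have /mx_norm_neq0[[i k]] : mx_norm x0 != 0 by rewrite -[mx_norm _]/(`|x0|) x01 oner_eq0.
  by rewrite -[mx_norm _]/(`|x0|) x01 ord1 => /= e; exists k.
have [s [s1 sk]] : exists s : R, (s = 1 \/ s = -1) /\ s * x0 0 k = 1.
  have [h|h] := ger0P (x0 0 k) ; rewrite ?(ger0_norm h) ?(ltr0_norm h) in xk.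
  - by exists 1; rewrite mul1r; split; [left|].
  - by exists (-1); rewrite mulN1r; split; [right|].
have sx i : s * x0 0 i <= 1.
  by have := rV_coord_le x0 i; rewrite x01 ler_norml; case: s1 => ->; lra.
pose t := [tuple s * x0 0 i | i < 4].
have /tuple_permP[p tp] : perm_eq (sort_tuple <=%O t) t by rewrite perm_sort.
exists s, p; split=> //.
pose x := s *: col_perm p x0; rewrite -/x.
have xE i : x 0 i = s * x0 0 (p i) by rewrite !mxE.
have xt i : x 0 i = nth 0 (sort <=%O t) i.
  rewrite -[sort _ _]/(tval (sort_tuple <=%O t)) tp -(tnth_nth 0 _ i).
  by rewrite !tnth_mktuple xE.
have xs (i j : 'I_4) : (i <= j)%N -> x 0 i <= x 0 j.
  move=> ij; rewrite !xt; apply: (sorted_leq_nth le_trans le_refl) => //.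
  - exact: sort_le_sorted.
  - by rewrite inE size_sort size_tuple.
  - by rewrite inE size_sort size_tuple.
have x3 : x 0 (inord 3) = 1.
  apply/le_anti; rewrite xE sx /= -xE -sk -[k](permKV p) -xE; apply: xs.
  by rewrite inordK// -ltnS ltn_ord.
split; last by rewrite sum_weight.
move=> i; rewrite /weight divr_ge0// subr_ge0 x3; case: eqP => [_|/eqP i0].
  by have := rV_coord_le x0 (p i); rewrite xE x01 ler_norml; case: s1 => ->; lra.
by apply: xs; rewrite inordK ?leq_pred// (leq_ltn_trans (leq_pred i)).
Qed.

Lemma AHSp4_with_BPBp gamma : AHSp4_with Y gamma ->
  BPBp_with 'rV[R]_4 Y (fun e => gamma (e / 3%:R) ^+ 2).
Proof.
move=> hY; have [mg _] := hY.
split; first by apply: modulus_sqr; apply: modulus_comp_div => //; lra.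
move=> e e01 T sT x0 x01 Tx0.
have [s [p [s1 hp]]] := sort_onto_simplex _ x01.
have ss : s * s = 1 by case: s1 => ->; lra.
have ns : `|s| = 1 by case: s1 => ->; rewrite ?normrN normr1.
(* Signed permutations are linear isometries of the max norm. The simplex case is applied to
   [T \o G], with [G] the inverse of [F p], and its result is carried back by [G u] and [S \o F]. *)
pose F q : {linear 'rV[R]_4 -> 'rV[R]_4} := s \*: (col_perm q : {linear 'rV[R]_4 -> 'rV[R]_4}).
have FK q : cancel (F q) (F q^-1%g).
  by move=> x; apply/rowP => i; rewrite !mxE permKV mulrA ss mul1r.
have nF q x : `|F q x| <= `|x|.
  apply/rV_norm_leP => // i; rewrite !mxE normrM ns mul1r; exact: rV_coord_le.
have nFE q x : `|F q x| = `|x|.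
  by apply/le_anti; rewrite nF -{1}(FK q x) nF.
have [G [nG FG GF]] : exists G : {linear 'rV[R]_4 -> 'rV[R]_4},
    [/\ forall x, `|G x| = `|x|, cancel (F p) G & cancel G (F p)].
  by exists (F p^-1%g); split=> //; have := FK p^-1%g; rewrite invgK.
move: (F p) (nFE p) FG GF (hp : simplex (F p x0)) => {hp nF nFE FK}F nF FG GF hp.
pose T' : {linear 'rV[R]_4 -> Y} := T \o G.
have T'1 x : `|x| <= 1 -> `|T' x| <= 1.
  by move=> x1; apply: (op_norm1_contracting T sT.2); rewrite nG.
have sT' : op_sphere _ _ T'.
  apply: contracting_op_sphere => //; rewrite -sT.2; apply: op_norm_le => x x1.
  by rewrite -(FG x); apply: (le_op_norm T' 1) => //; rewrite nF.
have T'x : 1 - gamma (e / 3) ^+ 2 < `|T' (F x0)| by rewrite /T' /= FG.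
have [u [S [u1 S1 Su ux [c ce ST]]]] := AHSp4_approx_simplex _ _ _ _ hY e01 sT' hp T'x.
exists (G u), (S \o F); split.
- by rewrite /unit_sphere /= nG.
- apply: contracting_op_sphere => [x x1|]; first by apply: S1; rewrite nF.
  rewrite -Su -[u]GF; apply: (le_op_norm (S \o F) 1) => [x x1|]; last by rewrite nG u1.
  by apply: S1; rewrite nF.
- by rewrite /= GF.
- by rewrite -(FG x0) -linearB nG.
- apply: le_lt_trans ce; apply: op_norm_le => x x1 /=.
  by have := ST (F x); rewrite nF /= FG; apply.
Qed.

End AHSpBPBp.

Theorem theorem3p3 (R : realType) (Y : completeNormedModType R) :
  [/\ BPBp 'rV[R]_4 Y <-> AHSp4 Y,
      forall eta : R -> R, BPBp_with 'rV[R]_4 Y eta ->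
        AHSp4_with Y (fun e => eta (e / 48%:R))
    & forall gamma : R -> R, AHSp4_with Y gamma ->
        BPBp_with 'rV[R]_4 Y (fun e => gamma (e / 3%:R) ^+ 2)].
Proof.
split; [|exact: BPBp_with_AHSp4|exact: AHSp4_with_BPBp].
split=> [[eta /BPBp_with_AHSp4 h]|[gamma /AHSp4_with_BPBp h]]; by eexists; exact: h.
Qed.
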